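(* Let $0\le a<b$, let $f:[a,b]\to\mathbb{R}$ be continuous, and let $P=[P^{\mathrm{left}},P^{\mathrm{right}}]\subset(-\infty,0)$ be a compact interval. For each integer $n\ge 1$, let $\varphi_n$ be the approximation of $f$ produced by the orthogonal greedy algorithm (OGA) with dictionary $\mathcal{D}(P)$ and input integer $n$, and let $\varphi_n^*$ be the approximation of $f$ produced by the improved OGA with dictionary $\mathcal{D}(P)$ and input integer $n$ (both defined in the context, using the same sequence of greedy selections $g_1,g_2,\dots$). Then $$\|f-\varphi_n^*\|_\infty\le\|f-\varphi_n\|_\infty\quad\text{for all } n\ge 1,$$ and $$\|f-\varphi_n^*\|_\infty\le\|f-\varphi_m^*\|_\infty\quad\text{for all } n\ge m\ge 1 .$$
   Context: Norms: $\|u\|_\infty=\sup_{z\in[a,b]}|u(z)|$ for $u\in C([a,b])$, and $(u,v)=\int_a^b u(z)v(z)\,dz$ is the $L^2$ inner product on $[a,b]$. Dictionary: $\mathcal{D}(P)=\{g_{(p)} : p\in P\}$, where $$g_{(p)}(z)=\left(\frac{1}{a-p}-\frac{1}{b-p}\right)^{-1/2}\frac{1}{z-p},\qquad z\in[a,b],$$ so that each element has unit $L^2$ norm on $[a,b]$. OGA: set $\varphi_0=0$, $r_0=f$. For $k=1,2,\dots,n$: (i) greedy step: choose $g_k\in\mathcal{D}(P)$ with $(r_{k-1},g_k)=\max_{g\in\mathcal{D}(P)}(r_{k-1},g)$ (any maximizer); (ii) let $\varphi_k=\sum_{i=1}^k c_i g_i$ be the $L^2$-orthogonal projection of $f$ onto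 $\operatorname{span}\{g_1,\dots,g_k\}$; (iii) set $r_k=f-\varphi_k$. The output with input integer $n$ is $\varphi_n$. Improved OGA with input integer $n$: run the OGA for $n$ steps to obtain $g_1,\dots,g_n$, and then output a best uniform approximation $\varphi_n^*$ of $f$ from $H_n=\operatorname{span}\{g_1,\dots,g_n\}$, i.e. $\varphi_n^*\in H_n$ with $\|f-\varphi_n^*\|_\infty=\min_{\varphi\in H_n}\|f-\varphi\|_\infty$ (any minimizer; in practice the projection coefficients $c_i$ are used as the initial guess of the minimization). The greedy selections do not depend on the input integer: runs with input integers $m\le n$ use the same $g_1,\dots,g_m$ (the same choice of maximizers is made whenever these are not unique), and the OGA and the improved OGA use the same selections. *)

(* Defs.v *)
From mathcomp Require Import all_boot all_order all_algebra.
From mathcomp Require Import all_classical all_reals all_analysis.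

Set Implicit Arguments.
Unset Strict Implicit.
Unset Printing Implicit Defensive.

Import Order.TTheory GRing.Theory Num.Theory.
Import numFieldNormedType.Exports.

Local Open Scope classical_set_scope.
Local Open Scope ring_scope.

(* An element of C([a, b]) is represented by a total function R -> R; the norm,
   the inner product and continuity only see its values on [a, b]. *)

(* [sup] takes values in R, so this is the uniform norm only for functions that
   are bounded on [a, b], such as the continuous ones. *)
Definition supnorm (R : realType) (a b : R) (u : R -> R) : R :=
  sup [set `|u z| | z in `[a, b]].

Definition inner (R : realType) (a b : R) (u v : R -> R) : R :=
  \int[lebesgue_measure]_(z in `[a, b]) (u z * v z).

Definition dict_elt (R : realType) (a b p : R) : R -> R :=
  fun z => ((a - p)^-1 - (b - p)^-1) `^ (- 2^-1) * (z - p)^-1.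

Definition dictionary (R : realType) (a b : R) (P : set R) : set (R -> R) :=
  [set dict_elt a b p | p in P].

(* The sequence starts at index 1: the value [g 0] is never used. *)
Definition span_upto (R : realType) (g : nat -> R -> R) (n : nat) :
    set (R -> R) :=
  [set u | exists c : nat -> R,
     u = fun z => \sum_(1 <= i < n.+1) c i * g i z].

Definition is_maximizer (R : realType) (a b : R) (D : set (R -> R))
    (r g : R -> R) : Prop :=
  D g /\ forall h, D h -> inner a b r h <= inner a b r g.

Definition is_orth_proj (R : realType) (a b : R) (H : set (R -> R))
    (f u : R -> R) : Prop :=
  H u /\ forall h, H h -> inner a b (f \- u) h = 0.

Definition is_best_uniform (R : realType) (a b : R) (H : set (R -> R))
    (f u : R -> R) : Prop :=
  H u /\ forall h, H h -> supnorm a b (f \- u) <= supnorm a b (f \- h).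

(* The maximizers being arbitrary, the algorithm is a relation: [g], [phi] and
   [r] record the selections, approximations and residuals of an n-step run. *)
Definition OGA_run (R : realType) (a b : R) (D : set (R -> R)) (f : R -> R)
    (n : nat) (g phi r : nat -> R -> R) : Prop :=
  [/\ phi 0%N = (fun=> 0),
      r 0%N = f &
      forall k, (1 <= k <= n)%N ->
        [/\ is_maximizer a b D (r k.-1) (g k),
            is_orth_proj a b (span_upto g k) f (phi k) &
            r k = f \- phi k]].

Definition OGA_output (R : realType) (a b : R) (D : set (R -> R))
    (f : R -> R) (g : nat -> R -> R) (n : nat) (u : R -> R) : Prop :=
  exists phi r : nat -> R -> R, OGA_run a b D f n g phi r /\ u = phi n.

Definition improved_OGA_output (R : realType) (a b : R) (D : set (R -> R))
    (f : R -> R) (g : nat -> R -> R) (n : nat) (u : R -> R) : Prop :=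
  (exists phi r : nat -> R -> R, OGA_run a b D f n g phi r) /\
  is_best_uniform a b (span_upto g n) f u.

(* Main.v *)
Require Import Defs.
From mathcomp Require Import all_boot all_order all_algebra.
From mathcomp Require Import all_classical all_reals all_analysis.

Import Order.TTheory GRing.Theory Num.Theory.
Import numFieldNormedType.Exports.

Local Open Scope classical_set_scope.
Local Open Scope ring_scope.

(** A best approximation is at least as good as any competitor from the same
    space, so each inequality only asks that the right-hand approximation lie in
    [H_n], the span of the first [n] selections.  The OGA output [phi n] does,
    being a projection onto [H_n].  The earlier output [phistar m] does, because
    all runs share the selections [g], so that the spaces are nested
    ([span_upto_subset]). *)

Lemma span_upto_subset (R : realType) (g : nat -> R -> R) (m n : nat) :
  (m <= n)%N -> span_upto g m `<=` span_upto g n.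
Proof.
move=> le_mn u [c ->].
exists (fun i => if (i <= m)%N then c i else 0).
apply/funext => z; rewrite [RHS](big_cat_nat (n := m.+1)) //=.
rewrite [X in _ = _ + X]big_nat_cond [X in _ = _ + X]big1 ?addr0.
  by apply: eq_big_nat => i /andP[_]; rewrite ltnS => ->.
by move=> i /andP[/andP[lt_mi _] _]; rewrite leqNgt lt_mi mul0r.
Qed.

Lemma OGA_output_span (R : realType) (a b : R) (D : set (R -> R))
    (f : R -> R) (g : nat -> R -> R) (n : nat) (u : R -> R) :
  (1 <= n)%N -> OGA_output a b D f g n u -> span_upto g n u.
Proof.
move=> n_gt0 [phi [r [[_ _ step] ->]]].
by have [|_ [] //] := step n; rewrite n_gt0 leqnn.
Qed.

Theorem theorem3p2 (R : realType) (a b : R) (f : R -> R) (Pleft Pright : R)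
    (g phi phistar : nat -> R -> R)
    (ha : 0 <= a) (hab : a < b)
    (hf : {within `[a, b], continuous f})
    (hP : Pleft <= Pright) (hP0 : Pright < 0)
    (hphi : forall n : nat, (1 <= n)%N ->
       OGA_output a b (dictionary a b `[Pleft, Pright]) f g n (phi n))
    (hphistar : forall n : nat, (1 <= n)%N ->
       improved_OGA_output a b (dictionary a b `[Pleft, Pright]) f g n
         (phistar n)) :
  (forall n : nat, (1 <= n)%N ->
     supnorm a b (f \- phistar n) <= supnorm a b (f \- phi n)) /\
  (forall m n : nat, (1 <= m)%N -> (m <= n)%N ->
     supnorm a b (f \- phistar n) <= supnorm a b (f \- phistar m)).
Proof.
split=> [n n_gt0 | m n m_gt0 le_mn].
  have [_ [_ best]] := hphistar n n_gt0.
  by apply: best; apply: OGA_output_span (hphi n n_gt0).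
have [_ [_ best]] := hphistar n (leq_trans m_gt0 le_mn).
have [_ [Hm _]] := hphistar m m_gt0.
by apply: best; apply: span_upto_subset Hm.
Qed.
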